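(* For every integer $n\geq 3$, the cycle $C_{2n+1}$ on $2n+1$ vertices is in $\mathsf{Forb}_2$.
   Context: All graphs are finite, simple and connected. For a connected graph $G$ with vertex set $V(G)$ of size $m$, $d_G(u,v)$ is the number of edges of a shortest path between $u$ and $v$; $X_G=\{x_u : u\in V(G)\}$ is a set of indeterminates; the generalized distance matrix $D(G,X_G)$ is the $m\times m$ matrix over $\mathbb{Z}[X_G]$, indexed by $V(G)$, with $uu$-entry $x_u$ and $uv$-entry $d_G(u,v)$ for $u\neq v$. For $1\leq i\leq m$, the $i$-th distance ideal $I_i(G,X_G)$ is the ideal of $\mathbb{Z}[X_G]$ generated by the determinants of all $i\times i$ submatrices of $D(G,X_G)$ (any choice of $i$ rows and $i$ columns). An ideal is trivial if it equals $\langle 1\rangle$. A connected graph $G$ is forbidden for $\Lambda_2$ if its third distance ideal $I_3(G,X_G)$ is trivial (so $G$ has at least $3$ vertices). $\mathsf{Forb}_2$, the set of minimal forbidden graphs for $\Lambda_2$, consists of the connected graphs $H$ such that: (i) $H$ is forbidden for $\Lambda_2$; (ii) no proper connected induced subgraph of $H$ is forbidden for $\Lambda_2$; (iii) every connected graph $G$ containing $H$ as an induced subgraph is forbidden for $\Lambda_2$. *)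

(* Defs.v *)
From HB Require Import structures.
From mathcomp Require Import all_boot all_algebra.
From mathcomp Require Import mpoly.

Set Implicit Arguments.
Unset Strict Implicit.
Unset Printing Implicit Defensive.

Import GRing.Theory.
Local Open Scope ring_scope.

Record sgraph := SGraph {
  svertex :> finType;
  sedge : rel svertex;
  sedge_sym : ssrbool.symmetric sedge;
  sedge_irrefl : irreflexive sedge }.

Definition connected (G : sgraph) : Prop :=
  (0 < #|G|)%N /\ forall u v : G, connect (@sedge G) u v.

(* A path has pairwise distinct vertices, hence fewer than #|G| edges; the
   bounded search returns the junk value #|G| only when there is no path. *)
Definition gdist (G : sgraph) (u v : G) : nat :=
  find (fun k => [exists p : k.-tuple G,
                   [&& path (@sedge G) u p, last u p == v & uniq (u :: p)]])
       (iota 0 #|G|).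

Definition giso (G H : sgraph) : Prop :=
  exists f : G -> H,
    bijective f /\ forall u v : G, sedge (f u) (f v) = sedge u v.

Section Induced.
Variables (G : sgraph) (S : {set G}).

Definition induced_rel : rel {x : G | x \in S} :=
  fun u v => sedge (val u) (val v).

Lemma induced_sym : ssrbool.symmetric induced_rel.
Proof. by move=> u v; apply: sedge_sym. Qed.

Lemma induced_irrefl : irreflexive induced_rel.
Proof. by move=> u; apply: sedge_irrefl. Qed.

Definition induced : sgraph := SGraph induced_sym induced_irrefl.
End Induced.

Definition contains_induced (G H : sgraph) : Prop :=
  exists S : {set G}, giso H (induced S).

Section Cycle.
Variable m : nat.

(* The clause i != j only matters for m <= 1. *)
Definition cycle_rel : rel 'I_m :=
  fun i j => (i != j) && ((j == ordS i) || (i == ordS j)).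

Lemma cycle_sym : ssrbool.symmetric cycle_rel.
Proof. by move=> i j; rewrite /cycle_rel eq_sym orbC. Qed.

Lemma cycle_irrefl : irreflexive cycle_rel.
Proof. by move=> i; rewrite /cycle_rel eqxx. Qed.

Definition cycle_graph : sgraph := SGraph cycle_sym cycle_irrefl.
End Cycle.

Definition ideal_gen (R : comNzRingType) (S : R -> Prop) (p : R) : Prop :=
  exists (n : nat) (a s : 'I_n -> R),
    (forall i, S (s i)) /\ p = \sum_(i < n) a i * s i.

Definition trivial_ideal (R : comNzRingType) (J : R -> Prop) : Prop :=
  forall p, J p <-> ideal_gen (fun q => q = 1) p.

(* V(G) is identified with 'I_#|G| along enum_val; the variable x_u is
   'X_(enum_rank u). *)
Definition gdist_mx (G : sgraph) : 'M[{mpoly int[#|G|]}]_#|G| :=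
  \matrix_(i, j) if i == j then 'X_i
                 else (gdist (enum_val i) (enum_val j))%:R.

(* A choice of k rows (or columns) is a strictly increasing map from 'I_k. *)
Definition is_minor (R : comNzRingType) (m k : nat) (A : 'M[R]_m) (p : R) :
    Prop :=
  exists f g : 'I_k -> 'I_m,
    [/\ {homo f : i j / (i < j)%N}, {homo g : i j / (i < j)%N}
      & p = \det (mxsub f g A)].

Definition distance_ideal (k : nat) (G : sgraph) : {mpoly int[#|G|]} -> Prop :=
  ideal_gen (is_minor k (gdist_mx G)).

Definition forbidden (k : nat) (G : sgraph) : Prop :=
  trivial_ideal (distance_ideal k.+1 (G := G)).

Definition Forb (k : nat) (H : sgraph) : Prop :=
  [/\ connected H,
      forbidden k H,
      forall S : {set H},
        S \proper [set: H] -> connected (induced S) -> ~ forbidden k (induced S)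
    & forall G : sgraph,
        connected G -> contains_induced G H -> forbidden k G].

(* Main.v *)
Require Import Defs.
From mathcomp Require Import all_boot all_fingroup all_algebra mpoly ring zify.

Set Implicit Arguments.
Unset Strict Implicit.
Unset Printing Implicit Defensive.

Import GRing.Theory.

(** Why odd cycles of length at least 7 are minimal forbidden graphs.

    Minimality.  A proper connected induced subgraph of a cycle is a path, hence
    bipartite.  In a bipartite graph the distance between u and v is, modulo 2,
    the sum of the colours of u and v.  Evaluating all variables at 0 in the
    field with two elements thus turns the distance matrix into a matrix
    with entries p_i + q_j, of rank at most 2; all 3-minors vanish there, and
    the third distance ideal cannot contain 1 ([bipartite_not_forbidden]).

    Forbiddenness.  Let G be connected and contain the cycle v_0, v_1, ...
    (indices modulo m = 2n + 1) as an induced subgraph.  Distances in G may be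
    shorter than in the cycle, but little freedom is left: consecutive vertices
    are at distance 1, d(v_i, v_(i+2)) = 2, and a_i = d(v_i, v_(i+3)) is 2 or 3.
    Put b_i = d(v_i, v_(i+4)) and let x_i be the variable of v_i.  A handful of
    explicit 3-minors supported on six consecutive vertices relate the x_i to the
    a_i and b_i.  The ideal J of the 3-minors contains 1 as soon as this holds
    both after inverting 2 and after adding 2 to J
    ([ideal1_of_at_2_and_away_from_2]).

    - With 2 invertible ([ideal1_away_from_2]), six consecutive vertices suffice
      when a_i = a_(i+1) = a_(i+2): eliminating the variables leaves 1, or else
      3 and then 1, in J.  They also suffice when a_i = 2 and a_(i+1) = 3.  Since
      the sequence a is periodic, one of these situations occurs.

    - Modulo 2 ([ideal1_at_2]), a_i = 2 makes one of the minors a unit, so all a_i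
      may be taken to be 3.  The minors then give x_i x_(i+1) = 0 and
      x_i = x_(i+2), so that all x_i are equal because m is odd; this excludes
      b_i = 3.  When every b_i is even, rows i and i+2 of the matrix agree
      modulo J.  As m is odd all rows agree, although in column 0 rows 1 and 2
      contain 1 and 2: hence 1 is in J. *)

(** * Ideals *)

Section Ideals.
Local Open Scope ring_scope.

Record is_ideal (R : comNzRingType) (J : R -> Prop) : Prop := IsIdeal {
  ideal0 : J 0;
  idealD : forall p q, J p -> J q -> J (p + q);
  idealM : forall a p, J p -> J (a * p) }.

Section IdealTheory.
Variables (R : comNzRingType) (J : R -> Prop).
Hypothesis Jid : is_ideal J.

Lemma ideal_comb1 p a r : J p -> r = a * p -> J r.
Proof. by move=> Jp ->; apply: (idealM Jid). Qed.

Lemma ideal_comb2 p q a b r : J p -> J q -> r = a * p + b * q -> J r.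
Proof. by move=> Jp Jq ->; apply: (idealD Jid); apply: (idealM Jid). Qed.

Lemma ideal_comb3 p q s a b c r :
  J p -> J q -> J s -> r = a * p + b * q + c * s -> J r.
Proof.
by move=> Jp Jq Js ->; apply: (idealD Jid);
  [apply: (idealD Jid)|]; apply: (idealM Jid).
Qed.

Lemma ideal_all p : J 1 -> J p.
Proof. by move=> J1; apply: (ideal_comb1 (a := p) J1); rewrite mulr1. Qed.

(** An ideal is the unit ideal when it is so in the ring of coefficients modulo 2
    and in the localization away from 2.  The two hypotheses are applied to the
    sum of J with the ideal of 2, and to the saturation of J by the powers of 2;
    1 - 2q and 2^k in J then give 1 in J. *)
Lemma ideal1_of_at_2_and_away_from_2 :
    (forall K : R -> Prop, is_ideal K -> (forall p, J p -> K p) ->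
       K 2 -> K 1) ->
    (forall K : R -> Prop, is_ideal K -> (forall p, J p -> K p) ->
       (forall p, K (2 * p) -> K p) -> K 1) ->
  J 1.
Proof.
move=> at2 away2.
have [q Jq] : exists q, J (1 - 2 * q).
  apply: (at2 (fun p => exists q, J (p - 2 * q))); first split.
  - by exists 0; rewrite mulr0 subr0; apply: (ideal0 Jid).
  - move=> p p' [q Jq] [q' Jq']; exists (q + q').
    by apply: (ideal_comb2 (a := 1) (b := 1) Jq Jq'); ring.
  - move=> a p [q Jq]; exists (a * q).
    by apply: (ideal_comb1 (a := a) Jq); ring.
  - by move=> p Jp; exists 0; rewrite mulr0 subr0.
  - by exists 1; rewrite mulr1 subrr; apply: (ideal0 Jid).
have [k] : exists k : nat, J (2 ^+ k * 1).
  apply: (away2 (fun p => exists k : nat, J (2 ^+ k * p))); first split.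
  - by exists 0%N; rewrite mulr0; apply: (ideal0 Jid).
  - move=> p p' [k Jk] [k' Jk']; exists (k + k')%N.
    apply: (ideal_comb2 (a := 2 ^+ k') (b := 2 ^+ k) Jk Jk').
    by rewrite exprD; ring.
  - move=> a p [k Jk]; exists k.
    by apply: (ideal_comb1 (a := a) Jk); ring.
  - by move=> p Jp; exists 0%N; rewrite expr0 mul1r.
  - by move=> p [k Jk]; exists k.+1; rewrite exprSr -mulrA.
elim: k => [|k IHk]; first by rewrite expr0 mulr1.
rewrite exprS => Jk; apply: IHk.
by apply: (ideal_comb2 (a := 2 ^+ k) (b := q) Jq Jk); ring.
Qed.
End IdealTheory.

Lemma ideal_gen_is_ideal (R : comNzRingType) (S : R -> Prop) :
  is_ideal (ideal_gen S).
Proof.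
split.
- by exists 0%N, (fun=> 0), (fun=> 0); rewrite big_ord0; split=> // -[].
- move=> _ _ [n1 [a1 [s1 [S1 ->]]]] [n2 [a2 [s2 [S2 ->]]]].
  pose glue (h1 : 'I_n1 -> R) (h2 : 'I_n2 -> R) i :=
    match split i with inl j => h1 j | inr j => h2 j end.
  exists (n1 + n2)%N, (glue a1 a2), (glue s1 s2); split=> [i|].
    by rewrite /glue; case: (split i).
  rewrite big_split_ord /glue /=.
  by congr (_ + _); apply: eq_bigr => i _;
    [have := unsplitK (inl i : 'I_n1 + 'I_n2)
    |have := unsplitK (inr i : 'I_n1 + 'I_n2)] => /= ->.
- move=> b _ [n [a [s [Ss ->]]]].
  exists n, (fun i => b * a i), s; split=> //.
  by rewrite mulr_sumr; apply: eq_bigr => i _; rewrite mulrA.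
Qed.

Lemma ideal_gen_mem (R : comNzRingType) (S : R -> Prop) p :
  S p -> ideal_gen S p.
Proof.
move=> Sp; exists 1%N, (fun=> 1), (fun=> p); split=> //.
by rewrite big_ord1 mul1r.
Qed.

Lemma trivial_idealP (R : comNzRingType) (J : R -> Prop) :
  is_ideal J -> trivial_ideal J <-> J 1.
Proof.
move=> Jid; split=> [/(_ 1)-> | J1 p].
  exact: ideal_gen_mem.
split=> _; last exact: (ideal_all Jid).
apply: (ideal_all (ideal_gen_is_ideal _)).
exact: ideal_gen_mem.
Qed.

End Ideals.

(** * Minors of arbitrary rows and columns *)

Section Minors.
Local Open Scope ring_scope.

(** The permutation sends i to the number of values of f below f i. *)
Lemma sort_injection m k (f : 'I_k -> 'I_m) : injective f ->
  exists (h : 'I_k -> 'I_m) (s : 'S_k),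
    {homo h : i j / (i < j)%N} /\ forall i, f i = h (s i).
Proof.
move=> inj_f; pose below i := [set j | (f j < f i)%N].
have below_mono i j : (f i < f j)%N -> (#|below i| < #|below j|)%N.
  move=> ltij; apply: proper_card; apply/properP; split.
    by apply/subsetP=> l; rewrite !inE => /ltn_trans->.
  by exists i; rewrite !inE ?ltnn.
have below_lt i : (#|below i| < k)%N.
  rewrite -[k in (_ < k)%N]card_ord -cardsT; apply: proper_card.
  by apply/properP; split; [apply: subsetT | exists i; rewrite !inE ?ltnn].
have rank_inj : injective (fun i => Ordinal (below_lt i)).
  move=> i j /(congr1 val) eq_rank.
  have {}eq_rank : #|below i| = #|below j| := eq_rank.
  by case: (ltngtP (f i) (f j)) => [/below_mono|/below_mono|/val_inj/inj_f//];
    rewrite eq_rank ltnn.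
exists (fun i => f ((perm rank_inj)^-1 i)%g), (perm rank_inj); split.
  move=> i j; rewrite -{1}(permKV (perm rank_inj) i).
  rewrite -{1}(permKV (perm rank_inj) j) !permE /=.
  apply: contraLR; rewrite -!leqNgt leq_eqVlt.
  by move=> /predU1P[/val_inj/inj_f->|/below_mono/ltnW].
by move=> i; rewrite permK.
Qed.

(** Reordering rows or columns changes a minor by a sign, and repeating one makes
    it zero; the increasing choices therefore already generate every other
    choice, and concrete minors can be written down in any convenient order. *)
Lemma ideal_det_mxsub (R : comNzRingType) (J : R -> Prop) m k (A : 'M[R]_m)
    (f g : 'I_k -> 'I_m) :
  is_ideal J -> (forall p, is_minor k A p -> J p) -> J (\det (mxsub f g A)).
Proof.
move=> Jid Jminor.
have mul_perm (s : 'S_k) (B : 'M[R]_k) :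
    \det (row_perm s B) = (-1) ^+ s * \det B.
  by rewrite row_permE det_mulmx det_perm.
have [/injectiveP inj_f | /injectivePn[i [j neq_ij eq_fij]]] :=
  boolP (injectiveb f); last first.
  rewrite (determinant_alternate neq_ij) => [|l];
    [apply: (ideal0 Jid) | by rewrite !mxE eq_fij].
have [/injectiveP inj_g | /injectivePn[i [j neq_ij eq_gij]]] :=
  boolP (injectiveb g); last first.
  rewrite -det_tr (determinant_alternate neq_ij) => [|l];
    [apply: (ideal0 Jid) | by rewrite !mxE eq_gij].
have [hf [s [hf_lt fE]]] := sort_injection inj_f.
have [hg [t [hg_lt gE]]] := sort_injection inj_g.
have -> : mxsub f g A = row_perm s (row_perm t (mxsub hf hg A)^T)^T.
  by apply/matrixP=> i j; rewrite !mxE fE gE.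
rewrite mul_perm det_tr mul_perm det_tr.
by do 2!apply: (idealM Jid) => //; apply: Jminor; exists hf, hg.
Qed.

Definition det3 (R : comNzRingType) (T : Type) (M : T -> T -> R)
    (r0 r1 r2 c0 c1 c2 : T) : R :=
  M r0 c0 * (M r1 c1 * M r2 c2 - M r1 c2 * M r2 c1)
  - M r0 c1 * (M r1 c0 * M r2 c2 - M r1 c2 * M r2 c0)
  + M r0 c2 * (M r1 c0 * M r2 c1 - M r1 c1 * M r2 c0).

(** The lists nth ranges over serve only to present det3 M, whose index type is
    arbitrary, as a determinant of a matrix. *)
Lemma det3E (R : comNzRingType) (T : Type) (M : T -> T -> R)
    (r0 r1 r2 c0 c1 c2 : T) :
  \det (\matrix_(i < 3, j < 3)
          M (nth r0 [:: r0; r1; r2] i) (nth c0 [:: c0; c1; c2] j))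
    = det3 M r0 r1 r2 c0 c1 c2.
Proof.
rewrite (expand_det_row _ ord0) !big_ord_recl big_ord0 /cofactor.
rewrite !(expand_det_row _ ord0) !big_ord_recl !big_ord0 /cofactor !det_mx11.
by rewrite !mxE /= /bump /= /det3; ring.
Qed.

End Minors.

(** * Minors along an induced odd cycle *)

(** In this section X i j is the entry of the distance matrix at the vertices
    v_i and v_j of a closed walk v, and delta k i is the distance from v_i to
    v_(i+k).  Only what the induced cycle forces on distances within six
    consecutive vertices is assumed; the diagonal of X is arbitrary. *)
Section OddCycleMinors.
Local Open Scope ring_scope.
Variables (R : comNzRingType) (X : nat -> nat -> R) (delta : nat -> nat -> nat).
Hypotheses
  (X_right : forall k i, (0 < k < 6)%N -> X i (k + i) = (delta k i)%:R)
  (X_left : forall k i, (0 < k < 6)%N -> X (k + i) i = (delta k i)%:R)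
  (delta1 : forall i, delta 1 i = 1%N)
  (delta2 : forall i, delta 2 i = 2%N)
  (delta3 : forall i, (2 <= delta 3 i <= 3)%N)
  (delta4 : forall i, (2 <= delta 4 i <= minn (delta 3 i) (delta 3 i.+1) + 1)%N)
  (delta5 : forall i, (2 <= delta 5 i <= delta 4 i + 1)%N).

Let x i := X i i.
Let a i : R := (delta 3 i)%:R.
Let b i : R := (delta 4 i)%:R.

Lemma X1r i : X i i.+1 = 1. Proof. by rewrite (X_right (k := 1)) // delta1. Qed.
Lemma X1l i : X i.+1 i = 1. Proof. by rewrite (X_left (k := 1)) // delta1. Qed.
Lemma X2r i : X i i.+2 = 2. Proof. by rewrite (X_right (k := 2)) // delta2. Qed.
Lemma X2l i : X i.+2 i = 2. Proof. by rewrite (X_left (k := 2)) // delta2. Qed.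
Lemma X3r i : X i i.+3 = a i. Proof. exact: (X_right (k := 3)). Qed.
Lemma X3l i : X i.+3 i = a i. Proof. exact: (X_left (k := 3)). Qed.
Lemma X4r i : X i i.+4 = b i. Proof. exact: (X_right (k := 4)). Qed.
Lemma X5r i : X i i.+4.+1 = (delta 5 i)%:R.
Proof. exact: (X_right (k := 5)). Qed.
Let XE := (X1r, X1l, X2r, X2l, X3r, X3l, X4r, X5r).

Variable J : R -> Prop.
Hypothesis Jid : is_ideal J.
Hypothesis Jdet3 : forall r0 r1 r2 c0 c1 c2, J (det3 X r0 r1 r2 c0 c1 c2).

(** The rows and columns of the following minors are chosen so that most of them
    meet the diagonal at most twice and hence involve at most two variables. *)
Lemma minor_upper i :
  J (5 - a i - 2 * x i.+1 - 2 * x i.+2 + a i * (x i.+1 * x i.+2)).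
Proof.
apply: (ideal_comb1 Jid (a := 1) (Jdet3 i i.+1 i.+2 i.+1 i.+2 i.+3)).
by rewrite /det3 !XE /x; ring.
Qed.

Lemma minor_skew i :
  J (x i * x i.+1 - 2 * x i + a i + 3 - 2 * a i * x i.+1).
Proof.
apply: (ideal_comb1 Jid (a := 1) (Jdet3 i i.+1 i.+3 i i.+1 i.+2)).
by rewrite /det3 !XE /x; ring.
Qed.

Lemma minor_skew_rev i :
  J (x i.+3 * x i.+2 - 2 * x i.+3 + a i + 3 - 2 * a i * x i.+2).
Proof.
apply: (ideal_comb1 Jid (a := 1) (Jdet3 i.+3 i.+2 i i.+3 i.+2 i.+1)).
by rewrite /det3 !XE /x; ring.
Qed.

(** The rows i, i+1, i+2 satisfy a linear relation that is read off the columns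
    i+3 and i+4; it is stated in an arbitrary column c. *)
Lemma minor_rows i c :
  J (X i c * (4 - a i.+1) - X i.+1 c * (2 * a i - b i)
     + X i.+2 c * (a i * a i.+1 - 2 * b i)).
Proof.
apply: (ideal_comb1 Jid (a := 1) (Jdet3 i i.+1 i.+2 c i.+3 i.+4)).
by rewrite /det3 !XE; ring.
Qed.

Lemma minor_middle i :
  J (8 - 2 * a i - 2 * a i.+1 + b i + (a i * a i.+1 - 2 * b i) * x i.+2).
Proof.
apply: (ideal_comb1 Jid (a := 1) (minor_rows i i.+2)).
by rewrite !XE /x; ring.
Qed.

Lemma minor_ends i :
  J (4 - 3 * a i.+2 - (delta 5 i)%:R + 2 * ((delta 5 i)%:R - 1) * x i.+2).
Proof.
apply: (ideal_comb1 Jid (a := 1) (Jdet3 i i.+3 i.+2 i.+1 i.+2 i.+4.+1)).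
by rewrite /det3 !XE /x; ring.
Qed.

Lemma minor_principal i :
  J (x i * (x i.+1 * x i.+2) - x i - 4 * x i.+1 - x i.+2 + 4).
Proof.
apply: (ideal_comb1 Jid (a := 1) (Jdet3 i i.+1 i.+2 i i.+1 i.+2)).
by rewrite /det3 !XE /x; ring.
Qed.

Lemma a_cases i : delta 3 i = 2%N \/ delta 3 i = 3%N.
Proof. by have := delta3 i; lia. Qed.

(** ** Away from 2

    The numerical coefficients below carry out an elimination of the variables, as
    one would perform it in a field of characteristic other than 2. *)
Section Away.
Hypothesis cancel2 : forall p, J (2 * p) -> J p.

(** The case b_i = 3 is immediate from one minor.  If b_i = 2, the minors force
    x_(i+2) = 0, x_(i+3) = 1 and 3 = 0; then the rows of v_i and v_(i+3) are
    opposite in characteristic 3, which is impossible in column i+5, where the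
    entries are 2 and a distance between 2 and 3. *)
Lemma ideal1_of_ascent i : delta 3 i = 2%N -> delta 3 i.+1 = 3%N -> J 1.
Proof.
move=> a2 a3; have := minor_middle i.
have [b2|b3] : delta 4 i = 2%N \/ delta 4 i = 3%N by have := delta4 i; lia.
  rewrite /a /b a2 a3 b2 => mid.
  have Jx2 : J (x i.+2).
    by apply: cancel2; apply: (ideal_comb1 Jid (a := 1) mid); ring.
  have Jx3 : J (1 - x i.+3).
    apply: cancel2; move: (minor_upper i.+1); rewrite /a a3 => up.
    by apply: (ideal_comb2 Jid (a := 1) (b := 2 - 3 * x i.+3) up Jx2); ring.
  have J3 : J 3.
    move: (minor_skew_rev i); rewrite /a a2 => sk.
    by apply: (ideal_comb3 Jid (a := 1) (b := 4 - x i.+3)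
      (c := - 2) sk Jx2 Jx3); ring.
  have := minor_ends i; set e := delta 5 i => ends.
  have J1e : J (1 - e%:R).
    apply: (ideal_comb3 Jid (a := 1) (b := - 2 * (e%:R - 1))
      (c := a i.+2 - 1) ends Jx2 J3).
    by ring.
  have [e2|e3] : e = 2%N \/ e = 3%N by have := delta5 i; rewrite -/e; lia.
    by apply: (ideal_comb1 Jid (a := - 1) J1e); rewrite e2; ring.
  apply: cancel2; apply: (ideal_comb1 Jid (a := - 1) J1e).
  by rewrite e3; ring.
rewrite /a /b a2 a3 b3 => mid.
by apply: (ideal_comb1 Jid (a := 1) mid); ring.
Qed.

(** If one of the b is 2, a minor is equal to 2.  Otherwise 2 x = 3 for the two
    middle vertices, and the two other minors on them give 3 and 7. *)
Lemma ideal1_of_three_a2 i :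
  delta 3 i = 2%N -> delta 3 i.+1 = 2%N -> delta 3 i.+2 = 2%N -> J 1.
Proof.
move=> a0 a1 a2.
have mid j : delta 3 j = 2%N -> delta 3 j.+1 = 2%N -> J 1 \/ J (3 - 2 * x j.+2).
  move=> aj aj1; have := minor_middle j.
  have [bj|bj] : delta 4 j = 2%N \/ delta 4 j = 3%N by have := delta4 j; lia.
    rewrite /a /b aj aj1 bj => Jm; left.
    by apply: cancel2; apply: (ideal_comb1 Jid (a := 1) Jm); ring.
  rewrite /a /b aj aj1 bj => Jm; right.
  by apply: (ideal_comb1 Jid (a := 1) Jm); ring.
have [//|Jx] := mid i a0 a1; have [//|Jy] := mid i.+1 a1 a2.
have J3 : J 3.
  have := minor_upper i.+1; rewrite /a a1 => up.
  by apply: (ideal_comb3 Jid (a := 2) (b := 2 * x i.+3 - 2)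
    (c := 1) up Jx Jy); ring.
have := minor_skew i.+2; rewrite /a a2 => sk.
have J7 : J (- 7).
  apply: (ideal_comb3 Jid (a := 4) (b := 2 * x i.+3 - 4) (c := - 5) sk Jx Jy).
  by ring.
by apply: (ideal_comb2 Jid (a := - 1) (b := - 2) J7 J3); ring.
Qed.

(** The skew minor and its mirror image differ by 4 (x_(i+2) - x_(i+3)), so the
    two middle variables agree.  Their common value y satisfies two quadratic
    equations, from which 5 y = 4 and 3 = 0; the middle minor, linear in y,
    contradicts this for each value of b_i. *)
Lemma ideal1_of_three_a3 i :
  delta 3 i = 3%N -> delta 3 i.+1 = 3%N -> delta 3 i.+2 = 3%N -> J 1.
Proof.
move=> a0 a1 a2.
have := minor_skew_rev i; rewrite /a a0 => sk'.
have := minor_skew i.+2; rewrite /a a2 => sk.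
have := minor_upper i.+1; rewrite /a a1 => up.
have := minor_middle i; rewrite /a a0 a1.
set y := x i.+2 in sk sk' up *; set z := x i.+3 in sk sk' up * => mid.
have Jyz : J (y - z).
  do 2!apply: cancel2.
  by apply: (ideal_comb2 Jid (a := 1) (b := - 1) sk sk'); ring.
have J5y : J (5 * y - 4).
  do 2!apply: cancel2.
  apply: (ideal_comb3 Jid (a := 1) (b := - 3) (c := 16) up sk Jyz); ring.
have J3 : J 3.
  apply: cancel2.
  apply: (ideal_comb3 Jid (a := 25) (b := 36 - 5 * y)
    (c := 25 * y - 150) sk J5y Jyz).
  by ring.
have : delta 4 i = 2%N \/ delta 4 i = 3%N \/ delta 4 i = 4%N.
  by have := delta4 i; lia.
rewrite /b in mid *; case=> [b2|[b3|b4]]; move: mid; rewrite ?b2 ?b3 ?b4 => mid.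
- by apply: cancel2; apply: (ideal_comb2 Jid (a := - 1) (b := 1) J5y mid); ring.
- by apply: (ideal_comb2 Jid (a := y) (b := - 1) J3 mid); ring.
- do 2!apply: cancel2.
  by apply: (ideal_comb2 Jid (a := - 1) (b := 5) J5y mid); ring.
Qed.

Lemma exists_ascent i k : delta 3 i = 2%N -> delta 3 (k + i) = 3%N ->
  exists j, delta 3 j = 2%N /\ delta 3 j.+1 = 3%N.
Proof.
elim: k => [|k IHk] ai ak; first by rewrite ai in ak.
have [ak'|ak'] := a_cases (k + i); last exact: IHk.
by exists (k + i)%N.
Qed.

(** If a_0, a_1, a_2 are not all equal, then by periodicity the value 2 is at some
    later place followed by 3, even when the first change is from 3 to 2. *)
Lemma ideal1_away_from_2 m :
  (forall i, delta 3 (m + i) = delta 3 i) -> (2 < m)%N -> J 1.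
Proof.
move=> delta_per m_gt2.
have ascent i k : delta 3 i = 2%N -> delta 3 (k + i) = 3%N -> J 1.
  move=> ai ak; have [j [aj aj1]] := exists_ascent ai ak.
  exact: (ideal1_of_ascent aj aj1).
have descent i k :
    (k <= m)%N -> delta 3 i = 3%N -> delta 3 (k + i) = 2%N -> J 1.
  move=> le_km ai ak; apply: (ascent (k + i)%N (m - k)%N ak).
  by rewrite addnA subnK // delta_per.
have [a0|a0] := a_cases 0; have [a1|a1] := a_cases 1; have [a2|a2] := a_cases 2.
- exact: (ideal1_of_three_a2 a0 a1 a2).
- exact: (ascent 0%N 2%N).
- exact: (ascent 0%N 1%N).
- exact: (ascent 0%N 1%N).
- exact: (descent 0%N 1%N (ltnW (ltnW m_gt2)) a0 a1).
- exact: (descent 0%N 1%N (ltnW (ltnW m_gt2)) a0 a1).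
- exact: (descent 0%N 2%N (ltnW m_gt2) a0 a2).
- exact: (ideal1_of_three_a3 a0 a1 a2).
Qed.
End Away.

(** ** Modulo 2 *)

Section At2.
Hypothesis J2 : J 2.

Lemma mod2_comb1 p r s t : J p -> r = s * p + 2 * t -> J r.
Proof.
by move=> Jp ->; apply: (ideal_comb2 Jid (a := s) (b := t) Jp J2); ring.
Qed.

Lemma ideal1_of_even_a i : delta 3 i = 2%N -> J 1.
Proof.
move=> ai; have := minor_upper i; rewrite /a ai => up.
by apply: (mod2_comb1 (s := 1)
  (t := x i.+1 + x i.+2 - 1 - x i.+1 * x i.+2) up); ring.
Qed.

(** Membership in J may be proved assuming a_i = 3: for a_i = 2 the ideal is
    everything. *)
Lemma mem_if_odd_a i p : (delta 3 i = 3%N -> J p) -> J p.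
Proof.
case: (a_cases i) => [/ideal1_of_even_a J1 _ | ai Jp]; last exact: Jp.
exact: (ideal_all Jid).
Qed.

Lemma x_mul_next i : J (x i.+1 * x i.+2).
Proof.
apply: (@mem_if_odd_a i) => ai; have := minor_upper i; rewrite /a ai => up.
by apply: (mod2_comb1 (s := 1)
  (t := x i.+1 + x i.+2 - 1 - x i.+1 * x i.+2) up); ring.
Qed.

Lemma x_step2 i : J (x i - x i.+2).
Proof.
have Jpr := ideal_comb2 Jid (a := 1) (b := - x i)
  (minor_principal i) (x_mul_next i) erefl.
apply: (mod2_comb1 (s := 1) (t := x i + 2 * x i.+1 - 2) Jpr).
by ring.
Qed.

(** With an odd period, steps of length 2 connect any index to the next one. *)
Lemma odd_period_const (F : nat -> R) n :
    (forall i, F ((n + n).+1 + i)%N = F i) -> (forall i, J (F i - F i.+2)) ->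
  forall i, J (F i.+1 - F i).
Proof.
move=> F_per F_step i.
have step k j : J (F j - F (k + k + j)%N).
  elim: k j => [|k IHk] j; first by rewrite subrr; apply: (ideal0 Jid).
  rewrite (_ : k.+1 + k.+1 + j = (k + k + j).+2)%N; last lia.
  by apply: (ideal_comb2 Jid (a := 1)
    (b := 1) (IHk j) (F_step (k + k + j)%N)); ring.
have := step n.+1 i;
  rewrite (_ : (_ + _ + i = (n + n).+1 + i.+1)%N) ?F_per; last lia.
by move=> Fi; apply: (ideal_comb1 Jid (a := - 1) Fi); ring.
Qed.

Variable n : nat.
Hypotheses
  (X_per_row : forall i j, X ((n + n).+1 + i) j = X i j)
  (X_per_col : forall i j, X i ((n + n).+1 + j) = X i j).

(** Modulo J all x_i are equal, to x say.  Consecutive variables have product 0,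
    so x^2 = 0, whereas b_i = 3 forces x = 1. *)
Lemma ideal1_of_odd_b i : delta 4 i = 3%N -> J 1.
Proof.
move=> bi; apply: (@mem_if_odd_a i) => ai; apply: (@mem_if_odd_a i.+1) => ai1.
have Jnext : J (x i.+3 - x i.+2).
  by apply: (odd_period_const (n := n)) x_step2 _ => j;
    rewrite /x X_per_row X_per_col.
have := minor_middle i; rewrite /a /b ai ai1 bi => mid.
have Jx1 : J (x i.+2 - 1).
  by apply: (mod2_comb1 (s := 1) (t := - x i.+2) mid); ring.
apply: (ideal_comb3 Jid (a := 1) (b := - x i.+2) (c := - (x i.+2 + 1))
  (x_mul_next i.+1) Jnext Jx1); ring.
Qed.

Lemma row_step2 i c : J (X i c - X i.+2 c).
Proof.
apply: (@mem_if_odd_a i) => ai; apply: (@mem_if_odd_a i.+1) => ai1.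
have := minor_rows i c; rewrite /a /b ai ai1 => rows.
have : delta 4 i = 2%N \/ delta 4 i = 3%N \/ delta 4 i = 4%N.
  by have := delta4 i; lia.
case=> [bi|[bi|bi]].
- rewrite bi in rows.
  by apply: (mod2_comb1 (s := 1) (t := 2 * X i.+1 c - 3 * X i.+2 c) rows); ring.
- exact: (ideal_all Jid _ (ideal1_of_odd_b bi)).
- rewrite bi in rows.
  by apply: (mod2_comb1 (s := 1) (t := X i.+1 c - X i.+2 c) rows); ring.
Qed.

Lemma ideal1_at_2 : J 1.
Proof.
(* In column 0, row 1 holds a distance 1 and row 2 a distance 2. *)
have /(_ 1%N)
  := odd_period_const (fun i => X_per_row i 0) (fun i => row_step2 i 0).
rewrite X1l X2l => J1.
by apply: (ideal_comb1 Jid (a := 1) J1); ring.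
Qed.
End At2.
End OddCycleMinors.

(** * Distances in a connected graph *)

Section Distance.
Variable G : sgraph.
Implicit Types (u v w : G) (p : seq G).

Lemma gdist_le_uniq u p : path (@sedge G) u p -> uniq (u :: p) ->
  gdist u (last u p) <= size p < #|G|.
Proof.
move=> e_p uniq_p.
have lt_p : size p < #|G|
  by rewrite -[(size p).+1]/(size (u :: p)) -(card_uniqP uniq_p) max_card.
rewrite lt_p andbT leqNgt; apply/negP => lt_find.
have := before_find 0 lt_find; rewrite nth_iota // add0n => /existsP[].
by exists (in_tuple p); rewrite /= e_p eqxx; exact: uniq_p.
Qed.

Lemma gdist_le_path u p : path (@sedge G) u p -> gdist u (last u p) <= size p.
Proof.
case/shortenP=> q e_q uniq_q sub_qp.
have /andP[le_q _] := gdist_le_uniq e_q uniq_q.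
apply: leq_trans le_q _; apply: uniq_leq_size => //.
by case/andP: uniq_q.
Qed.

Hypothesis Gconn : connected G.

Lemma gdist_geodesic u v : exists p,
  [/\ path (@sedge G) u p, last u p = v & size p = gdist u v].
Proof.
have /connectP[p /shortenP[q e_q uniq_q _] ->] := Gconn.2 u v.
have /andP[le_q lt_q] := gdist_le_uniq e_q uniq_q.
have lt_d := leq_ltn_trans le_q lt_q.
have := lt_d; rewrite {1}/gdist -[X in _ < X](size_iota 0) -has_find.
move=> /(nth_find 0); rewrite -/(gdist u _) nth_iota // add0n.
case/existsP=> t /and3P[e_t /eqP last_t _].
by exists t; rewrite size_tuple.
Qed.

Lemma gdist_sym u v : gdist u v = gdist v u.
Proof.
suff le_d w z : gdist w z <= gdist z w by apply/eqP; rewrite eqn_leq !le_d.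
have [p [e_p <- <-]] := gdist_geodesic z w.
have := gdist_le_path (u := last z p) (p := rev (belast z p)).
rewrite rev_path size_rev size_belast.
have -> : last (last z p) (rev (belast z p)) = z.
  by case: p {e_p} => // y p; rewrite rev_cons last_rcons.
by apply; rewrite (eq_path (e' := @sedge G)) // => y y'; rewrite sedge_sym.
Qed.

Lemma gdist_edge_le u v w : sedge v w -> gdist u w <= (gdist u v).+1.
Proof.
move=> e_vw; have [p [e_p last_p <-]] := gdist_geodesic u v.
have := gdist_le_path (u := u) (p := rcons p w).
by rewrite rcons_path e_p last_p last_rcons size_rcons; apply.
Qed.

Lemma gdist_gt0 u v : u != v -> 0 < gdist u v.
Proof.
by have [[|w p] [_ last_p <-]] := gdist_geodesic u v;
  rewrite ?last_p //= -last_p eqxx.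
Qed.

Lemma gdist_gt1 u v : u != v -> ~~ sedge u v -> 1 < gdist u v.
Proof.
have [[|w [|z p]] [e_p last_p <-]] := gdist_geodesic u v => //.
  by rewrite -last_p eqxx.
by rewrite -last_p /= (andP e_p).1.
Qed.

Lemma gdist_edge u v : sedge u v -> gdist u v = 1.
Proof.
move=> e_uv; apply/eqP; rewrite eqn_leq gdist_gt0 ?andbT.
  by apply: (gdist_le_path (p := [:: v])); rewrite /= e_uv.
by apply: contraTneq e_uv => ->; rewrite sedge_irrefl.
Qed.

Lemma odd_gdist (c : G -> bool) :
    (forall u v, sedge u v -> c u != c v) ->
  forall u v, odd (gdist u v) = c u (+) c v.
Proof.
move=> proper_c u v; have [p [e_p <- <-]] := gdist_geodesic u v.
elim: p u e_p => [|w p IHp] u /=; first by rewrite addbb.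
case/andP=> /proper_c c_uw /IHp->.
by move: c_uw; case: (c u); case: (c w); case: (c _).
Qed.
End Distance.

(** * Distance ideals *)

Lemma distance_minor (G : sgraph) (K : {mpoly int[#|G|]} -> Prop) (T : Type)
    (v : T -> G) :
  is_ideal K -> (forall p, distance_ideal 3 p -> K p) ->
  forall r0 r1 r2 c0 c1 c2 : T,
    K (det3 (fun i j => gdist_mx G (enum_rank (v i)) (enum_rank (v j)))
         r0 r1 r2 c0 c1 c2).
Proof.
move=> Kid subK r0 r1 r2 c0 c1 c2; rewrite -det3E.
pose f (t0 t1 t2 : T) (i : 'I_3) := enum_rank (v (nth t0 [:: t0; t1; t2] i)).
have := @ideal_det_mxsub _ K _ 3 (gdist_mx G) (f r0 r1 r2) (f c0 c1 c2) Kid.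
have -> : mxsub (f r0 r1 r2) (f c0 c1 c2) (gdist_mx G) =
  (\matrix_(i < 3, j < 3) gdist_mx G (enum_rank (v (nth r0 [:: r0; r1; r2] i)))
     (enum_rank (v (nth c0 [:: c0; c1; c2] j))))%R.
  by apply/matrixP=> i j; rewrite !mxE.
by apply=> p minor_p; apply: subK; apply: ideal_gen_mem.
Qed.

Lemma gdist_mx_neq (G : sgraph) (u v : G) : u != v ->
  gdist_mx G (enum_rank u) (enum_rank v) = ((gdist u v)%:R)%R.
Proof.
by move=> neq_uv; rewrite mxE (inj_eq enum_rank_inj) (negPf neq_uv) !enum_rankK.
Qed.

Lemma forbidden2P G :
  forbidden 2 G <-> distance_ideal 3 (1 : {mpoly int[#|G|]})%R.
Proof. exact/trivial_idealP/ideal_gen_is_ideal. Qed.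

(** * Vertices of a cycle *)

Section CycleVertices.
Variable m : nat.
Hypothesis m_gt0 : 0 < m.

(** Numbering the vertices by all natural numbers makes going around the cycle
    a matter of adding m. *)
Definition cycle_vertex i : cycle_graph m := Ordinal (ltn_pmod i m_gt0).

Lemma cycle_vertex_period i : cycle_vertex (m + i) = cycle_vertex i.
Proof. by apply/val_inj; rewrite /= modnDl. Qed.

Lemma cycle_vertex_neq k i : 0 < k < m ->
  cycle_vertex i != cycle_vertex (k + i).
Proof.
move=> /andP[k_gt0 lt_km].
rewrite -val_eqE /= -[in X in X != _](add0n i) eqn_modDr.
by rewrite mod0n modn_small // eq_sym -lt0n.
Qed.

Lemma cycle_vertex_edge k i : 0 < k < m.-1 ->
  sedge (cycle_vertex i) (cycle_vertex (k + i)) = (k == 1).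
Proof.
move=> /andP[k_gt0 lt_km]; rewrite /= /cycle_rel cycle_vertex_neq; last lia.
rewrite -!val_eqE /= -[(i %% m).+1]add1n -[((k + i) %% m).+1]add1n !modnDmr.
rewrite eqn_modDr addnA -[i %% m]/((0 + i) %% m) eqn_modDr.
by rewrite !modn_small; lia.
Qed.

Lemma cycle_vertex_val (u : cycle_graph m) : cycle_vertex u = u.
Proof. by apply/val_inj; rewrite /= modn_small. Qed.
End CycleVertices.

Lemma cycle_connected m : 2 < m -> connected (cycle_graph m).
Proof.
move=> m_gt2; have m_gt0 : 0 < m by lia.
split; first by rewrite card_ord.
have from0 i : connect (@sedge (cycle_graph m))
    (cycle_vertex m_gt0 0) (cycle_vertex m_gt0 i).
  elim: i => [|i IHi]; first exact: connect0.
  apply: (connect_trans IHi); apply: connect1.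
  by rewrite -add1n cycle_vertex_edge //; lia.
have csym := sym_connect_sym (@sedge_sym (cycle_graph m)).
move=> u v; rewrite -(cycle_vertex_val m_gt0 u) -(cycle_vertex_val m_gt0 v).
by apply: connect_trans (from0 v); rewrite csym.
Qed.

(** * Connected graphs containing an odd cycle *)

Lemma contains_induced_refl G : contains_induced G G.
Proof.
exists setT; exists (fun u => exist _ u (in_setT u)); split=> //.
by exists val => // -[u uT]; apply/val_inj.
Qed.

(** For m >= 7, vertices of the cycle up to five steps apart are distinct, and
    adjacent only if one step apart; stepping along the cycle changes distances
    by at most 1.  This gives all the bounds on distances the minors require. *)
Lemma odd_cycle_forbidden n G : 3 <= n -> connected G ->
  contains_induced G (cycle_graph (2 * n + 1)) -> forbidden 2 G.
Proof.
move=> n_ge3 Gconn [S [f [f_bij f_edge]]]; apply/forbidden2P.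
have m_gt0 : 0 < 2 * n + 1 by lia.
pose v i : G := val (f (cycle_vertex m_gt0 i)).
have v_per i : v ((n + n).+1 + i) = v i.
  by rewrite /v (_ : (n + n).+1 = 2 * n + 1) ?cycle_vertex_period //; lia.
have v_neq k i : 0 < k < 6 -> v i != v (k + i).
  move=> k_bd; rewrite /v val_eqE (inj_eq (bij_inj f_bij)).
  by apply: cycle_vertex_neq; lia.
have v_edge k i : 0 < k < 6 -> sedge (v i) (v (k + i)) = (k == 1).
  move=> k_bd; rewrite -[LHS]/(sedge (f _) (f _)) f_edge.
  by apply: cycle_vertex_edge; lia.
pose d k i := gdist (v i) (v (k + i)).
have v_next i : sedge (v i) (v i.+1) by rewrite (v_edge 1).
have d1 i : d 1 i = 1 by apply: gdist_edge => //; apply: v_next.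
have d_ge2 k i : 1 < k < 6 -> 2 <= d k i.
  by move=> k_bd; apply: gdist_gt1; rewrite ?v_neq ?v_edge //; lia.
have d_right k i : d k.+1 i <= (d k i).+1.
  by apply: gdist_edge_le => //; apply: v_next.
have d_left k i : d k.+1 i <= (d k i.+1).+1.
  rewrite /d ![gdist _ (v (_ + _))]gdist_sym // addSnnS.
  by apply: gdist_edge_le => //; rewrite sedge_sym.
have d2 i : d 2 i = 2.
  by have := d_ge2 2 i isT; have := d_right 1 i; rewrite d1; lia.
have d3 i : 2 <= d 3 i <= 3.
  by rewrite d_ge2 //=; have := d_right 2 i; rewrite d2.
have d4 i : 2 <= d 4 i <= minn (d 3 i) (d 3 i.+1) + 1.
  by have := d_ge2 4 i isT; have := d_right 3 i; have := d_left 3 i; lia.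
have d5 i : 2 <= d 5 i <= d 4 i + 1 by rewrite d_ge2 //= addn1 d_right.
pose X i j := gdist_mx G (enum_rank (v i)) (enum_rank (v j)).
have Xr k i : 0 < k < 6 -> X i (k + i) = ((d k i)%:R)%R.
  by move=> k_bd; rewrite /X gdist_mx_neq ?v_neq.
have Xl k i : 0 < k < 6 -> X (k + i) i = ((d k i)%:R)%R.
  by move=> k_bd; rewrite /X gdist_mx_neq 1?eq_sym ?v_neq // gdist_sym.
apply: ideal1_of_at_2_and_away_from_2; first exact: ideal_gen_is_ideal.
  move=> K Kid /(distance_minor v Kid) minorK K2.
  apply: (ideal1_at_2 Xr Xl d1 d2 d3 d4 Kid minorK K2 (n := n)) => i j.
    by rewrite /X v_per.
  by rewrite /X v_per.
move=> K Kid /(distance_minor v Kid) minorK cancel2.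
apply: (ideal1_away_from_2 Xr Xl d1 d2 d3 d4 d5 Kid minorK cancel2
  (m := (n + n).+1)) => [i|]; last lia.
by rewrite /d addnCA !v_per.
Qed.

(** * Bipartite graphs and proper subgraphs of a cycle *)

Lemma det_outer_sum (R : comNzRingType) (p q : 'I_3 -> R) :
  (\det (\matrix_(i, j) (p i + q j)) = 0)%R.
Proof.
pose M (i j : nat) : R := (p (inord i) + q (inord j))%R.
transitivity (det3 M 0 1 2 0 1 2); last by rewrite /det3 /M; ring.
rewrite -det3E; congr (\det _)%R; apply/matrixP=> i j.
by rewrite !mxE /M -[[:: 0; 1; 2]]/(iota 0 3) !nth_iota // !inord_val.
Qed.

Lemma bipartite_not_forbidden (G : sgraph) (c : G -> bool) : connected G ->
  (forall u v, sedge u v -> c u != c v) -> ~ forbidden 2 G.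
Proof.
move=> Gconn proper_c /forbidden2P[k [a [s [s_minor /esym]]]].
pose ev : {rmorphism {mpoly int[#|G|]} -> 'F_2} :=
  mmap (intr : {rmorphism int -> 'F_2}) (fun=> 0%R).
have natF2 (t : nat) : (t%:R = (odd t)%:R :> 'F_2)%R.
  by apply/val_inj;
    rewrite /= !val_Fp_nat // modn2 modn_small //; case: (odd t).
move/(congr1 ev); rewrite rmorph1 rmorph_sum big1 => [/eqP|i _].
  by rewrite eq_sym oner_eq0.
rewrite rmorphM /=; have [f [g [_ _ ->]]] := s_minor i.
rewrite -det_map_mx -[X in (\det X)%R](_ : \matrix_(i, j)
  ((c (enum_val (f i)))%:R + (c (enum_val (g j)))%:R) = _)%R.
  by rewrite det_outer_sum mulr0.
(* The diagonal fits the same formula, as 0 is twice a colour modulo 2. *)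
apply/matrixP=> i' j'; rewrite !mxE; case: eqP => [->|_].
  by rewrite /= mmapX mmap1U; case: (c _); apply/val_inj.
rewrite rmorph_nat [RHS]natF2 (odd_gdist Gconn proper_c).
by case: (c _); case: (c _); apply/val_inj.
Qed.

(** Parity of the label colours the cycle properly except at the edge joining
    the last vertex to vertex 0; swapping the colours of the labels below w
    moves the defect to the edge entering w. *)
Lemma punctured_odd_cycle_coloring n (w u v : cycle_graph (2 * n + 1)) :
  sedge u v -> u != w -> v != w ->
  odd u (+) (u < w) != odd v (+) (v < w).
Proof.
have step (y z : cycle_graph (2 * n + 1)) : z == ordS y -> y != w -> z != w ->
    odd y (+) (y < w) != odd z (+) (z < w).
  rewrite -!val_eqE /= => /eqP-> {z}.
  have := ltn_ord w; have := ltn_ord y => lt_y lt_w.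
  have -> : y.+1 %% (2 * n + 1) = if y == 2 * n :> nat then 0 else y.+1.
    case: eqP => [->|ne_y]; first by rewrite -[(2 * n).+1]addn1 modnn.
    by rewrite modn_small; lia.
  have [y_last|_] := eqVneq (y : nat) (2 * n); lia.
case/andP=> _ /orP[|] e_uv neq_uw neq_vw; first exact: step.
by rewrite eq_sym step.
Qed.

Theorem lemma16 (n : nat) (hn : 3 <= n) : Forb 2 (cycle_graph (2 * n + 1)).
Proof.
have Cconn : connected (cycle_graph (2 * n + 1)) by apply: cycle_connected; lia.
have forb G := @odd_cycle_forbidden n G hn.
split=> //; first by apply: forb => //; apply: contains_induced_refl.
move=> S /properP[_ [w _ w_notin]] Sconn.
have neq_w (u : induced S) : val u != w.
  by apply: contraNneq w_notin => <-; apply: valP.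
pose c (u : induced S) := odd (val u) (+) (val u < w).
apply: (bipartite_not_forbidden (c := c)) => // u v e_uv.
exact: (punctured_odd_cycle_coloring e_uv).
Qed.
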